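(* Let $M=(E,\rho)$ be a $(q,r)$-polymatroid with $\dim E=n$, and let $s \in \{0,\ldots ,n\}$. Then $$\sum_{i=0}^{n-s} \left[\begin{matrix} n-i\\ s\end{matrix}\right]_q A_M(i;z) = z^{\rho(E)-rs} \sum_{i=0}^s \left[\begin{matrix} n-i\\ s-i\end{matrix}\right]_q A_{M^*}(i;z).$$
   Context: $q$ is a prime power, $n,r$ are positive integers, $E$ is an $n$-dimensional $\mathbb{F}_q$-vector space, and $\mathcal{L}(E)$ is the lattice of subspaces of $E$; $\leq$ denotes inclusion of subspaces. $\left[\begin{matrix} a\\ b\end{matrix}\right]_q=\prod_{i=0}^{b-1}\frac{q^a-q^i}{q^b-q^i}$ is the Gaussian coefficient (the number of $b$-dimensional subspaces of an $a$-dimensional $\mathbb{F}_q$-space). A $(q,r)$-polymatroid is a pair $M=(E,\rho)$ with $\rho:\mathcal{L}(E)\to\mathbb{N}_0$ such that for all $A,B\leq E$: (R1) $0\leq\rho(A)\leq r\dim A$; (R2) $A\leq B$ implies $\rho(A)\leq\rho(B)$; (R3) $\rho(A+B)+\rho(A\cap B)\leq\rho(A)+\rho(B)$. Fix an involutory lattice anti-isomorphism $U\mapsto U^\perp$ of $\mathcal{L}(E)$ (an order-reversing bijection interchanging sums and intersections, with $U^{\perp\perp}=U$; hence $\dim U^\perp=n-\dim U$). The dual of $M$ is the $(q,r)$-polymatroid $M^*=(E,\rho^* )$, $\rho^*(A)=r\dim(A)-\rho(E)+\rho(A^\perp)$. For $T\leq E$, the contraction $M/T$ is the $(q,r)$-polymatroid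 on $E/T$ with rank function $\rho_{M/T}(A/T)=\rho(A)-\rho(T)$ for $T\leq A\leq E$. For $X\leq E$, the contraction of $M$ to $X$ is $M.X:=M/X^\perp$ (likewise for $M^*$). For a $(q,r)$-polymatroid $N$ on a space $F$, put $\ell_N(A)=\rho_N(F)-\rho_N(A)$ for $A\leq F$; its characteristic polynomial is $p(N;z)=\sum_{X\leq F}\mu(0,X)z^{\ell_N(X)}\in\mathbb{Z}[z]$, where $\mu$ is the Möbius function of $\mathcal{L}(F)$, i.e. $\mu(U,V)=(-1)^{v-u}q^{\binom{v-u}{2}}$ for $U\leq V$ of dimensions $u,v$. The weight enumerator of $M$ is the list $[A_M(i;z):0\leq i\leq n]$ with $A_M(i;z)=\sum_{X\leq E,\,\dim X=i}p(M.X;z)$ (and similarly for $M^*$). *)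

(* Defs.v *)
From HB Require Import structures.
From mathcomp Require Import all_boot all_order all_algebra all_field.
From mathcomp Require Import zify.

Set Implicit Arguments.
Unset Strict Implicit.
Unset Printing Implicit Defensive.

Import Order.TTheory GRing.Theory Num.Theory.
Local Open Scope ring_scope.

Section FiniteSubspaceLattice.
Import VectorInternalTheory.
HB.instance Definition _ (F : finFieldType) (E : vectType F) :=
  [Countable of {vspace E} by <:].
HB.instance Definition _ (F : finFieldType) (E : vectType F) :=
  [Finite of {vspace E} by <:].
End FiniteSubspaceLattice.

(* The additive coset quotient of the library, equipped with the induced
   scalar multiplication; it is finite-dimensional because it is isomorphic
   to any complement of T. *)
Section QuotientSpace.
Import VectorInternalTheory.
Local Open Scope quotient_scope.
Variables (F : fieldType) (E : vectType F) (T : {vspace E}).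

Definition quotv := Quotient.quot T.
HB.instance Definition _ := GRing.Zmodule.on quotv.
HB.instance Definition _ := Quotient.on quotv.

Definition quotv_scale (a : F) (x : quotv) : quotv := \pi_quotv (a *: repr x).

Lemma pi_quotv_eq (x y : E) : (\pi_quotv x == \pi_quotv y) = (x - y \in T).
Proof. by rewrite -Quotient.idealrBE. Qed.

Lemma quotvW (P : quotv -> Prop) : (forall x, P (\pi_quotv x)) -> forall x, P x.
Proof. by move=> Ppi x; rewrite -[x]reprK. Qed.

Lemma pi_quotvD (x y : E) : \pi_quotv (x + y) = \pi_quotv x + \pi_quotv y.
Proof. exact: (raddfD (\pi_(Quotient.quot T))). Qed.

Lemma pi_quotv_scale (a : F) (x : E) :
  quotv_scale a (\pi_quotv x) = \pi_quotv (a *: x).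
Proof.
apply/eqP; rewrite pi_quotv_eq -scalerBr; apply: memvZ.
by rewrite -pi_quotv_eq reprK.
Qed.

Fact quotv_scaleA a b (x : quotv) :
  quotv_scale a (quotv_scale b x) = quotv_scale (a * b) x.
Proof. by elim/quotvW: x => x; rewrite !pi_quotv_scale scalerA. Qed.

Fact quotv_scale1 : left_id 1 quotv_scale.
Proof. by elim/quotvW=> x; rewrite pi_quotv_scale scale1r. Qed.

Fact quotv_scaleDr : right_distributive quotv_scale +%R.
Proof.
move=> a; elim/quotvW=> x; elim/quotvW=> y.
by rewrite -pi_quotvD !pi_quotv_scale scalerDr pi_quotvD.
Qed.

Fact quotv_scaleDl (x : quotv) : {morph quotv_scale^~ x : a b / a + b}.
Proof.
move=> a b; elim/quotvW: x => x.
by rewrite !pi_quotv_scale scalerDl pi_quotvD.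
Qed.

HB.instance Definition _ := GRing.Zmodule_isLmodule.Build F quotv
  quotv_scaleA quotv_scale1 quotv_scaleDr quotv_scaleDl.

Fact pi_quotv_linear : linear (\pi_quotv : E -> quotv).
Proof. by move=> a x y; rewrite pi_quotvD -pi_quotv_scale. Qed.

Let compl_of (x : E) : subvs_of T^C%VS := vsproj T^C (daddv_pi T^C T x).

Let compl_of_linear : linear compl_of.
Proof. by move=> a x y; rewrite /compl_of !linearP. Qed.

Let compl_ofB x y : compl_of (x - y) = compl_of x - compl_of y.
Proof. by rewrite addrC -scaleN1r compl_of_linear scaleN1r addrC. Qed.

Let capTC : (T^C :&: T)%VS = 0%VS.
Proof. by rewrite capvC capv_compl. Qed.

Let compl_of_sub x : x - vsval (compl_of x) \in T.
Proof.
rewrite /compl_of vsprojK ?memv_pi //.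
have xE : x \in (T^C + T)%VS by rewrite addvC addv_complf memvf.
by rewrite -{1}(daddv_pi_add capTC xE) addrC addKr memv_pi.
Qed.

Let compl_of_T x : x \in T -> compl_of x = 0.
Proof.
move=> xT; apply/val_inj/eqP; rewrite /= -memv0 -capTC memv_cap subvsP /=.
by have := memvB xT (compl_of_sub x); rewrite opprB addrC subrK.
Qed.

Let compl_of_repr x : compl_of (repr (\pi_quotv x)) = compl_of x.
Proof.
by apply/eqP; rewrite -subr_eq0 -compl_ofB compl_of_T // -pi_quotv_eq reprK.
Qed.

Let v2r_linear (V : vectType F) : linear (@v2r F V).
Proof. exact: linearP. Qed.

Fact quotv_vect_iso : Vector.axiom (dim (subvs_of T^C%VS)) quotv.
Proof.
exists (fun x => v2r (compl_of (repr x))) => [a x y|].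
  transitivity (v2r (a *: compl_of (repr x) + compl_of (repr y))).
    rewrite -compl_of_linear; congr (v2r _).
    by rewrite -[RHS]compl_of_repr pi_quotv_linear !reprK.
  exact: v2r_linear.
exists (fun w => \pi_quotv (vsval (r2v w))) => [x|w].
  rewrite v2rK; apply/eqP.
  by rewrite -{2}[x]reprK eq_sym pi_quotv_eq compl_of_sub.
rewrite compl_of_repr -[RHS]r2vK; congr (v2r _).
by rewrite /compl_of daddv_pi_id ?subvsP // vsvalK.
Qed.

HB.instance Definition _ := Lmodule_hasFinDim.Build F quotv quotv_vect_iso.

Definition quotv_proj : 'Hom(E, quotv) := linfun (\pi_quotv : E -> quotv).

Lemma quotv_projE x : quotv_proj x = \pi_quotv x.
Proof.
pose piL := GRing.isLinear.Build F E quotv *:%R (\pi_quotv : E -> quotv)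
  pi_quotv_linear.
pose f : {linear E -> quotv} := HB.pack (\pi_quotv : E -> quotv) piL.
by rewrite /quotv_proj (lfunE f).
Qed.

Lemma lker_quotv_proj : lker quotv_proj = T.
Proof.
apply/vspaceP=> x; rewrite memv_ker quotv_projE.
have -> : (0 : quotv) = \pi_quotv 0 by rewrite -quotv_projE linear0.
by rewrite pi_quotv_eq subr0.
Qed.

Lemma limg_quotv_proj : limg quotv_proj = fullv.
Proof.
apply/vspaceP=> x; rewrite memvf; apply/memv_imgP.
by exists (repr x); rewrite ?memvf // quotv_projE reprK.
Qed.

End QuotientSpace.

(* Here q is #|F|. *)
Record qrpolymatroid (r : nat) (F : finFieldType) (E : vectType F) :=
  QRPolymatroid {
    rk :> {vspace E} -> nat;
    rk_le_dim : forall A : {vspace E}, (rk A <= r * \dim A)%N;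
    rk_mono : forall A B : {vspace E}, (A <= B)%VS -> (rk A <= rk B)%N;
    rk_submod : forall A B : {vspace E},
      (rk (A + B)%VS + rk (A :&: B)%VS <= rk A + rk B)%N
  }.

Record lattice_anti_involution (F : fieldType) (E : vectType F) :=
  LatticeAntiInvolution {
    perp :> {vspace E} -> {vspace E};
    perp_anti : forall U V : {vspace E},
      (U <= V)%VS -> (perp V <= perp U)%VS;
    perpD : forall U V : {vspace E}, perp (U + V)%VS = (perp U :&: perp V)%VS;
    perpI : forall U V : {vspace E}, perp (U :&: V)%VS = (perp U + perp V)%VS;
    perpK : involutive perp
  }.

Section AntiInvolutionTheory.
Variables (F : fieldType) (E : vectType F) (D : lattice_anti_involution E).

Lemma dim_perp (U : {vspace E}) : (\dim (D U) = \dim {:E} - \dim U)%N.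
Proof.
have lt_perp (V W : {vspace E}) : (V <= W)%VS -> (\dim V < \dim W)%N ->
    (\dim (D W) < \dim (D V))%N.
  move=> sVW ltVW; rewrite (ltn_leqif (dimv_leqif_sup (perp_anti D sVW))).
  apply: contraL ltVW => /(perp_anti D); rewrite !perpK -leqNgt.
  exact: dimvS.
have ub k : forall V, \dim V = k -> (\dim (D V) + k <= \dim {:E})%N.
  elim: k => [|k IHk] V dimV; first by rewrite addn0 dimvS ?subvf.
  have V0 : vpick V != 0 by rewrite vpick0 -dimv_eq0 dimV.
  pose W := (V :\: <[vpick V]>)%VS.
  have dimW : \dim W = k.
    have := dimv_cap_compl V <[vpick V]>%VS; rewrite -/W dimV.
    rewrite (capv_idPr _) ?dim_vline ?V0; last by rewrite -memvE memv_pick.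
    by move=> [].
  have := lt_perp W V (diffvSl _ _); rewrite dimV dimW ltnSn => /(_ isT).
  by have := IHk W dimW; lia.
have lb k : forall V, (\dim {:E} - \dim V = k)%N ->
    (\dim {:E} <= \dim (D V) + \dim V)%N.
  elim: k => [|k IHk] V dimV; first by lia.
  have [v vNV] : exists v, v \notin V.
    exists (vpick V^C); apply/negP=> vV.
    have : vpick V^C \in (V :&: V^C)%VS by rewrite memv_cap vV memv_pick.
    rewrite capv_compl memv0 vpick0 -dimv_eq0 dimv_compl; lia.
  have dimW : \dim (V + <[v]>)%VS = (\dim V).+1.
    rewrite dimv_disjoint_sum ?dim_vline; last first.
      apply/eqP; rewrite -subv0; apply/subvP=> w; rewrite memv_cap memv0.
      case/andP=> wV /vlineP[c wE]; rewrite wE.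
      case: (eqVneq c 0) => [->|c0]; first by rewrite scale0r.
      by move: vNV; rewrite -(scalerK c0 v) -wE memvZ.
    by case: eqVneq vNV => [->|]; rewrite ?mem0v // addn1.
  have := lt_perp V (V + <[v]>)%VS (addvSl _ _); rewrite dimW ltnSn.
  by move/(_ isT); have := IHk (V + <[v]>)%VS; rewrite dimW; lia.
by have := ub _ U erefl; have := lb _ U erefl; lia.
Qed.

End AntiInvolutionTheory.

Section PolymatroidOperations.
Variables (r : nat) (F : finFieldType) (E : vectType F).
Implicit Types (M : qrpolymatroid r E) (A B T : {vspace E}).

Lemma rk_le_codim M A B : (A <= B)%VS ->
  (M B + r * \dim A <= M A + r * \dim B)%N.
Proof.
move=> sAB; have := rk_submod M A (B :\: A)%VS.
have := rk_le_dim M (B :\: A)%VS; have := dimv_cap_compl B A.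
rewrite addvC addv_diff (addv_idPl sAB) (capv_idPr sAB) => <-.
by rewrite mulnDr; lia.
Qed.

Section Dual.
Variables (D : lattice_anti_involution E) (M : qrpolymatroid r E).

(* The truncated subtraction is exact, by dual_rkE. *)
Definition dual_rk (A : {vspace E}) : nat :=
  (r * \dim A + M (D A) - M fullv)%N.

Lemma dual_rkE A : (dual_rk A + M fullv = r * \dim A + M (D A))%N.
Proof.
have := rk_le_codim M (subvf (D A)); have := dimvS (subvf A).
rewrite /dual_rk dim_perp => le_dim.
have : (r * \dim {:E} = r * \dim A + r * (\dim {:E} - \dim A))%N.
  by rewrite -mulnDr subnKC.
lia.
Qed.

Fact dual_rk_le_dim A : (dual_rk A <= r * \dim A)%N.
Proof. by have := dual_rkE A; have := rk_mono M (subvf (D A)); lia. Qed.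

Fact dual_rk_mono A B : (A <= B)%VS -> (dual_rk A <= dual_rk B)%N.
Proof.
move=> sAB; have := rk_le_codim M (perp_anti D sAB).
have := dual_rkE A; have := dual_rkE B; rewrite !dim_perp.
have := dimvS sAB; have := dimvS (subvf B).
move: (\dim A) (\dim B) (\dim _) => a b n; rewrite !mulnBr.
move=> /(leq_mul (leqnn r)) ? /(leq_mul (leqnn r)) ?; lia.
Qed.

Fact dual_rk_submod A B :
  (dual_rk (A + B)%VS + dual_rk (A :&: B)%VS <= dual_rk A + dual_rk B)%N.
Proof.
have := dual_rkE A; have := dual_rkE B.
have := dual_rkE (A + B)%VS; have := dual_rkE (A :&: B)%VS.
have := rk_submod M (D A) (D B); rewrite perpD perpI.
have := congr1 (muln r) (dimv_sum_cap A B); rewrite !mulnDr; lia.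
Qed.

Definition dual : qrpolymatroid r E :=
  QRPolymatroid dual_rk_le_dim dual_rk_mono dual_rk_submod.

End Dual.

Section Contraction.
Variables (M : qrpolymatroid r E) (T : {vspace E}).
Local Notation pi := (quotv_proj T).

(* A subspace of E / T is A / T for a unique A containing T, namely its
   preimage under the projection. *)
Definition contract_rk (B : {vspace quotv T}) : nat :=
  (M (pi @^-1: B)%VS - M T)%N.

Lemma sub_quotv_preim (B : {vspace quotv T}) : (T <= pi @^-1: B)%VS.
Proof. by rewrite -{1}(lker_quotv_proj T) -lpreim0 lpreimS ?sub0v. Qed.

Lemma dim_quotv_preim (B : {vspace quotv T}) :
  (\dim (pi @^-1: B) = \dim B + \dim T)%N.
Proof.
have := limg_ker_dim pi (pi @^-1: B).
rewrite lpreimK ?limg_quotv_proj ?subvf // lker_quotv_proj.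
by rewrite (capv_idPr (sub_quotv_preim B)) addnC => <-.
Qed.

Lemma quotv_preimD (A B : {vspace quotv T}) :
  (pi @^-1: (A + B) <= pi @^-1: A + pi @^-1: B)%VS.
Proof.
apply/subvP=> x; rewrite -memv_preim => /memv_addP[a aA [b bB piE]].
have /memv_imgP[y _ yE] : a \in limg pi by rewrite limg_quotv_proj memvf.
rewrite -(subrK y x) addrC memv_add // -memv_preim -?yE //.
by rewrite linearB /= piE yE addrC addKr.
Qed.

Fact contract_rk_le_dim (B : {vspace quotv T}) :
  (contract_rk B <= r * \dim B)%N.
Proof.
have := rk_le_codim M (sub_quotv_preim B).
by rewrite dim_quotv_preim mulnDr /contract_rk; lia.
Qed.

Fact contract_rk_mono (A B : {vspace quotv T}) :
  (A <= B)%VS -> (contract_rk A <= contract_rk B)%N.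
Proof. by move=> sAB; rewrite leq_sub2r // rk_mono // lpreimS. Qed.

Fact contract_rk_submod (A B : {vspace quotv T}) :
  (contract_rk (A + B)%VS + contract_rk (A :&: B)%VS
     <= contract_rk A + contract_rk B)%N.
Proof.
have leT (C : {vspace quotv T}) := rk_mono M (sub_quotv_preim C).
have := rk_submod M (pi @^-1: A)%VS (pi @^-1: B)%VS.
have := rk_mono M (quotv_preimD A B).
have : (M (pi @^-1: (A :&: B))%VS <= M (pi @^-1: A :&: pi @^-1: B)%VS)%N.
  by rewrite rk_mono // subv_cap !lpreimS ?capvSl ?capvSr.
have := leT A; have := leT B; have := leT (A + B)%VS.
by have := leT (A :&: B)%VS; rewrite /contract_rk; lia.
Qed.

Definition contract : qrpolymatroid r (quotv T) :=
  QRPolymatroid contract_rk_le_dim contract_rk_mono contract_rk_submod.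

End Contraction.

Definition contract_to (D : lattice_anti_involution E) (M : qrpolymatroid r E)
  (X : {vspace E}) : qrpolymatroid r (quotv (D X)) := contract M (D X).

End PolymatroidOperations.

Section Mobius.
Variables (F : finFieldType) (E : vectType F).
Implicit Types U V W : {vspace E}.

(* k is recursion fuel: dim V is enough, since the dimension drops strictly
   in the recursive calls. *)
Fixpoint mobius_rec (k : nat) (U V : {vspace E}) : int :=
  if U == V then 1 else
  if k is k'.+1 then
    - \sum_(W : {vspace E} | (U <= W <= V)%VS && (W != V)) mobius_rec k' U W
  else 0.

(* The Moebius function of the lattice of subspaces; it vanishes when U is not
   contained in V. *)
Definition mobius U V : int := mobius_rec (\dim V) U V.

Lemma mobius_rec_fuel k U V : (\dim V <= k)%N -> mobius_rec k U V = mobius U V.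
Proof.
have dim_lt W V' : (W <= V')%VS && (W != V') -> (\dim W < \dim V')%N.
  by case/andP=> sWV; rewrite (ltn_leqif (dimv_leqif_eq sWV)).
have fuel0 k' V' : (\dim V' <= 0)%N -> mobius_rec k' U V' = (U == V')%:R.
  move=> dV; case: k' => [|k'] /=; case: eqP => // _.
  rewrite big1 ?oppr0 // => W /andP[/andP[_ sWV] neWV].
  by have := dim_lt W V'; rewrite sWV neWV => /(_ isT); lia.
suff fuel_eq m n V' : (\dim V' <= m)%N -> (\dim V' <= n)%N ->
    mobius_rec m U V' = mobius_rec n U V' by move=> leVk; apply: fuel_eq.
elim: m n V' => [|m IHm] [|n] V' leVm leVn; try by rewrite !fuel0.
rewrite /=; case: eqP => // _; congr (- _); apply: eq_bigr => W.
case/andP=> [/andP[_ sWV] neWV]; have := dim_lt W V'.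
by rewrite sWV neWV => /(_ isT) ltWV; apply: IHm; lia.
Qed.

Lemma mobius_refl U : mobius U U = 1.
Proof. by rewrite /mobius; case: (\dim U) => [|k] /=; rewrite eqxx. Qed.

Lemma mobius_sum0 U V : (U <= V)%VS -> U != V ->
  \sum_(W : {vspace E} | (U <= W <= V)%VS) mobius U W = 0.
Proof.
move=> sUV neUV; rewrite (bigD1 V) ?sUV ?subvv //=.
rewrite -(mobius_rec_fuel U (leqnSn (\dim V))) /= (negPf neUV).
rewrite addrC; apply/eqP; rewrite subr_eq0; apply/eqP/eq_bigr => W.
by case/andP=> [/andP[_ sWV] _]; rewrite mobius_rec_fuel ?dimvS.
Qed.

End Mobius.

(* \prod_(i < b) (q^a - q^i) / (q^b - q^i), read in a field of
   characteristic 0. *)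
Definition gauss_coef (K : fieldType) (q a b : nat) : K :=
  \prod_(i < b) ((q%:R ^+ a - q%:R ^+ i) / (q%:R ^+ b - q%:R ^+ i)).

Section WeightEnumerator.
Variables (r : nat) (F : finFieldType).

Definition corank (E : vectType F) (N : qrpolymatroid r E)
  (A : {vspace E}) : nat := (N fullv - N A)%N.

Definition charpol (E : vectType F) (N : qrpolymatroid r E) : {poly int} :=
  \sum_(X : {vspace E}) mobius 0%VS X *: 'X^(corank N X).

Definition weight_enum (E : vectType F) (D : lattice_anti_involution E)
  (M : qrpolymatroid r E) (i : nat) : {poly int} :=
  \sum_(X : {vspace E} | \dim X == i) charpol (contract_to D M X).

End WeightEnumerator.

(* Main.v *)
Require Import Defs.
From mathcomp Require Import all_boot all_order all_algebra all_field.
From mathcomp Require Import zify.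
Import Order.TTheory GRing.Theory Num.Theory.
Local Open Scope ring_scope.

Set Implicit Arguments.
Unset Strict Implicit.
Unset Printing Implicit Defensive.

(** Write q for #|F|, n for dim E and rho for the rank function of M.

    The charpol of the contraction of M to X is a sum over the interval above
    T = X^perp, namely
      sum_(T <= Y) mobius T Y *: 'X^(rho E - rho Y),
    because the lattice of E / T is that interval (charpol_contract).  Summing
    this over all X <= U amounts to summing over all T >= U^perp.  Exchanging
    the two sums, the coefficient of the monomial of Y becomes the sum of
    mobius T Y over U^perp <= T <= Y, which is 0 unless Y = U^perp.  So the
    whole sum collapses to one monomial (sum_charpol_sub):
      sum_(X <= U) charpol (M.X) = 'X^(rho E - rho (U^perp)).

    A Gaussian coefficient weighting A_M(i) counts, for each X of dimension i,
    the subspaces U >= X of some fixed dimension k.  Each side of the identity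
    is therefore a sum over pairs X <= U with dim U = k, and summing over X
    first turns it into a sum of monomials over the U of dimension k
    (sum_weight_enum).  On the left k = n - s, and the number of U is found
    through their orthogonals, the s-dimensional subspaces of X^perp
    (card_supspaces_perp).  On the right k = s, and the number of U is found
    through their images in E / X (card_supspaces).

    After replacing U by U^perp on the left, both sides run over the
    s-dimensional U.  The monomials are 'X^(rho E - rho U) for M and
    'X^(r s - rho U) for the dual of M (corank_dual_perp), and they differ
    exactly by the factor 'X^(rho E - r s). *)

(** * Counting subspaces *)

(** The vectors of E have to be gathered in a finite type to be counted, and
    finvect_type E is one.  Membership and spans are nevertheless taken in E
    itself, since the vector space structure of finvect_type E is not
    convertible to that of an abstract E. *)
Lemma card_vspace_mem (F : finFieldType) (E : vectType F) (U : {vspace E}) :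
  #|[pred x : finvect_type E | (x : E) \in U]| = (#|F| ^ \dim U)%N.
Proof.
(* The counting lemma speaks of an explicitly packed vector space. *)
case: E U => T cT U.
exact: (@card_vspace F (finvect_type (Vector.Pack cT)) cT U).
Qed.

Section Counting.
Variables (F : finFieldType) (E : vectType F).
Implicit Types V W : {vspace E}.

Lemma card_outside V W : (W <= V)%VS ->
  #|[pred x : finvect_type E | ((x : E) \in V) && ((x : E) \notin W)]|
    = (#|F| ^ \dim V - #|F| ^ \dim W)%N.
Proof.
move=> sWV; rewrite -!card_vspace_mem.
pose inW := [pred x : finvect_type E | (x : E) \in W].
rewrite -(cardID inW [pred x : finvect_type E | (x : E) \in V]).
have -> : #|[predI [pred x : finvect_type E | (x : E) \in V] & inW]| = #|inW|.
  by apply: eq_card => x; rewrite !inE /=; apply: andb_idl; move/(subvP sWV).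
by rewrite addKn; apply: eq_card => x; rewrite !inE andbC.
Qed.

(** A free family of b + 1 vectors of V is a free family t of b vectors of V
    preceded by a vector of V outside the span of t, which has q^b elements. *)
Lemma card_free_tuples V b :
  #|[pred t : b.-tuple (finvect_type E) |
      free (t : seq E) && (<<(t : seq E)>> <= V)%VS]|
    = (\prod_(i < b) (#|F| ^ \dim V - #|F| ^ i))%N.
Proof.
elim: b => [|b IHb].
  rewrite big_ord0; apply: (@eq_card1 _ [tuple]) => t.
  by rewrite [t]tuple0 !inE /= nil_free span_nil sub0v eqxx.
rewrite big_ord_recr /= -IHb -sum1_card.
pose ttail (t : b.+1.-tuple (finvect_type E)) := [tuple of behead t].
rewrite (partition_big ttail [pred t : b.-tuple (finvect_type E) |
    free (t : seq E) && (<<(t : seq E)>> <= V)%VS]) /=; last first.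
  case/tupleP=> x t; rewrite inE /= free_cons span_cons subv_add.
  by case/andP=> /andP[_ ->] /andP[_ ->].
rewrite -sum_nat_const; apply: eq_bigr => t /andP[ft stV].
have dimt : \dim <<(t : seq E)>> = b.
  by have := ft; rewrite /free size_tuple => /eqP.
rewrite -[in RHS]dimt -card_outside // -sum1_card.
rewrite (reindex (fun x => cons_tuple x t)) /=; last first.
  exists (@thead _ _) => [x _|u /andP[_ /eqP <-]]; first by rewrite theadE.
  by apply: val_inj; rewrite /= [u in RHS]tuple_eta.
apply: eq_bigl => x; rewrite !inE /= free_cons span_cons subv_add ft stV.
have -> : ttail (cons_tuple x t) = t by apply: val_inj.
by rewrite eqxx !andbT -memvE andbC.
Qed.

(** Sort the free b-tuples of V by their span W: those that span W are the free
    b-tuples of W, for reasons of dimension. *)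
Lemma card_subspaces_mul V b :
  (#|[pred W : {vspace E} | (W <= V)%VS && (\dim W == b)]|
     * \prod_(i < b) (#|F| ^ b - #|F| ^ i)
   = \prod_(i < b) (#|F| ^ \dim V - #|F| ^ i))%N.
Proof.
rewrite -card_free_tuples -[in RHS]sum1_card.
rewrite (partition_big (fun t : b.-tuple (finvect_type E) => <<(t : seq E)>>%VS)
   [pred W : {vspace E} | (W <= V)%VS && (\dim W == b)]) /=; last first.
  move=> t; rewrite inE /free size_tuple => /andP[/eqP dimt ->].
  by rewrite /= dimt eqxx.
rewrite -sum_nat_const; apply: eq_bigr => W /andP[sWV /eqP dW].
have := card_free_tuples W b; rewrite dW => <-.
rewrite -sum1_card; apply: eq_bigl => t; rewrite !inE.
apply/andP/andP => [[ft stW]|[/andP[ft _] /eqP <-]]; last by rewrite subvv.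
have /eqP tW : <<(t : seq E)>>%VS == W.
  by rewrite eqEdim stW dW /=; have := ft; rewrite /free size_tuple => /eqP ->.
by rewrite tW sWV ft eqxx.
Qed.

Lemma card_subspaces (K : fieldType) V b : [pchar K] =i pred0 ->
  (b <= \dim V)%N ->
  #|[pred W : {vspace E} | (W <= V)%VS && (\dim W == b)]|%:R
    = gauss_coef K #|F| (\dim V) b.
Proof.
move=> /pcharf0P K0 le_bV; have q_gt1 := finRing_gt1 F.
rewrite /gauss_coef prodf_div.
have expB a (i : 'I_b) : (b <= a)%N ->
    #|F|%:R ^+ a - #|F|%:R ^+ i = (#|F| ^ a - #|F| ^ i)%N%:R :> K.
  move=> le_ba; rewrite natrB ?natrX // leq_exp2l //.
  exact: leq_trans (ltnW (ltn_ord i)) le_ba.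
under eq_bigr => i _ do rewrite expB //.
under [X in _ / X]eq_bigr => i _ do rewrite expB //.
rewrite -!natr_prod -card_subspaces_mul natrM mulfK // K0 -lt0n.
by apply: prodn_gt0 => i; rewrite subn_gt0 ltn_exp2l.
Qed.

End Counting.

(** * The interval above a subspace as the lattice of the quotient *)

Section QuotientLattice.
Variables (F : finFieldType) (E : vectType F) (T : {vspace E}).
Local Notation pi := (quotv_proj T).

Lemma quotv_imgK (B : {vspace quotv T}) : (pi @: (pi @^-1: B))%VS = B.
Proof. by rewrite lpreimK // limg_quotv_proj subvf. Qed.

Lemma quotv_preimK (Y : {vspace E}) :
  (T <= Y)%VS -> (pi @^-1: (pi @: Y))%VS = Y.
Proof.
move=> sTY; apply/eqP; rewrite eq_sym eqEsubv; apply/andP; split.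
  by apply/subvP=> y yY; rewrite -memv_preim memv_img.
apply/subvP=> x; rewrite -memv_preim => /memv_imgP[y yY pixy].
rewrite -(subrK y x) memvD //; apply: (subvP sTY).
by rewrite -{1}(lker_quotv_proj T) memv_ker linearB /= pixy subrr.
Qed.

Lemma quotv_preim_full : (pi @^-1: fullv)%VS = fullv.
Proof. by apply/vspaceP=> x; rewrite -memv_preim !memvf. Qed.

Lemma quotv_preim_mono (A B : {vspace quotv T}) :
  (pi @^-1: A <= pi @^-1: B)%VS = (A <= B)%VS.
Proof.
apply/idP/idP=> [sAB|]; last exact: lpreimS.
by rewrite -[A]quotv_imgK -[B]quotv_imgK limgS.
Qed.

Lemma quotv_preim_inj : injective (fun B : {vspace quotv T} => (pi @^-1: B)%VS).
Proof. exact: can_inj quotv_imgK. Qed.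

Lemma reindex_quotv (R : Type) (idx : R) (op : Monoid.com_law idx)
    (P : pred {vspace E}) (G : {vspace E} -> R) :
  \big[op/idx]_(Y | (T <= Y)%VS && P Y) G Y
    = \big[op/idx]_(B : {vspace quotv T} | P (pi @^-1: B)%VS) G (pi @^-1: B)%VS.
Proof.
rewrite (reindex (fun B : {vspace quotv T} => (pi @^-1: B)%VS)) /=.
  by apply: eq_bigl => B; rewrite sub_quotv_preim.
exists (fun Y => (pi @: Y)%VS) => [B _|Y /andP[sTY _]]; first exact: quotv_imgK.
exact: quotv_preimK.
Qed.

Lemma card_supspaces (K : fieldType) k : [pchar K] =i pred0 ->
  (\dim T <= k <= \dim {:E})%N ->
  #|[pred U : {vspace E} | (T <= U)%VS && (\dim U == k)]|%:R
    = gauss_coef K #|F| (\dim {:E} - \dim T) (k - \dim T).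
Proof.
move=> K0 /andP[leTk lekn].
have dimQ : \dim {:quotv T} = (\dim {:E} - \dim T)%N.
  rewrite -(addnK (\dim T) (\dim {:quotv T})) -dim_quotv_preim.
  by rewrite quotv_preim_full.
rewrite -dimQ -card_subspaces //; last by rewrite dimQ leq_sub2r.
congr _%:R; rewrite -!sum1_card reindex_quotv; apply: eq_bigl => B.
by rewrite !inE subvf dim_quotv_preim; lia.
Qed.

(** Both sides satisfy the recursion that defines the Moebius function, and
    preimage is an isomorphism between the two intervals. *)
Lemma mobius_quotv (B : {vspace quotv T}) :
  mobius 0%VS B = mobius T (pi @^-1: B)%VS.
Proof.
have [m] := ubnP (\dim B); elim: m B => // m IHm B ltBm.
have preim0 : (pi @^-1: 0)%VS = T by rewrite lpreim0 lker_quotv_proj.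
have [->|B0] := eqVneq B 0%VS; first by rewrite preim0 !mobius_refl.
have TneB : T != (pi @^-1: B)%VS.
  by rewrite -{1}preim0 (inj_eq quotv_preim_inj) eq_sym.
have := mobius_sum0 (sub_quotv_preim B) TneB.
rewrite reindex_quotv (bigD1 B) ?subvv //=.
have := mobius_sum0 (sub0v B); rewrite eq_sym => /(_ B0).
rewrite (bigD1 B) ?sub0v ?subvv //= => sumB sumPB.
have -> : mobius 0%VS B = - \sum_(W : {vspace quotv T} |
    (0 <= W <= B)%VS && (W != B)) mobius 0%VS W.
  by apply/eqP; rewrite -addr_eq0 sumB.
apply/eqP; rewrite eq_sym -addr_eq0 -[X in _ == X]sumPB; apply/eqP.
congr (_ + _).
apply: eq_big => W; first by rewrite quotv_preim_mono sub0v.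
rewrite sub0v => /andP[/= sWB neWB].
rewrite IHm // -ltnS; apply: leq_trans ltBm; rewrite ltnS.
by rewrite (ltn_leqif (dimv_leqif_eq sWB)).
Qed.

Lemma charpol_contract r (M : qrpolymatroid r E) :
  charpol (contract M T)
    = \sum_(Y | (T <= Y)%VS) mobius T Y *: 'X^(M fullv - M Y).
Proof.
under [RHS]eq_bigl => Y do rewrite -[(T <= Y)%VS]andbT.
rewrite reindex_quotv; apply: eq_bigr => B _.
rewrite mobius_quotv /corank /= /contract_rk quotv_preim_full.
have ? := rk_mono M (sub_quotv_preim B).
by congr (_ *: 'X^_); lia.
Qed.

End QuotientLattice.

(** * The dual recursion of the Moebius function *)

(** Every recursive call has the form mobius U W with W inside V, so the case
    U = W that yields 1 is never reached. *)
Lemma mobius_notsub (F : finFieldType) (E : vectType F) (U V : {vspace E}) :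
  ~~ (U <= V)%VS -> mobius U V = 0.
Proof.
have [m] := ubnP (\dim V); elim: m V => // m IHm V ltVm nUV.
rewrite /mobius; case: (\dim V) => [|k] /=.
  by case: eqP nUV => // ->; rewrite subvv.
case: eqP nUV => [->|_ nUV]; first by rewrite subvv.
rewrite big_pred0 ?oppr0 // => W; apply/negP=> /andP[/andP[sUW sWV] _].
by rewrite (subv_trans sUW sWV) in nUV.
Qed.

Lemma mobius_sum_right (F : finFieldType) (E : vectType F) (U V : {vspace E}) :
  \sum_(W : {vspace E} | (W <= V)%VS) mobius U W = (U == V)%:R.
Proof.
rewrite (bigID (fun W => (U <= W)%VS)) /= [X in _ + X]big1 ?addr0; last first.
  by move=> W /andP[_ /mobius_notsub].
under eq_bigl => W do rewrite andbC.
have [->|neUV] := eqVneq U V.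
  rewrite (big_pred1 V) ?mobius_refl // => W.
  by rewrite -eqEsubv eq_sym.
have [sUV|nsUV] := boolP (U <= V)%VS; first exact: mobius_sum0.
rewrite big_pred0 // => W; apply: contraNF nsUV => /andP[].
exact: subv_trans.
Qed.

(** The defining recursion says that the matrix of the Moebius function is a
    left inverse of the matrix Ze of inclusion.  For square matrices it is then
    also a right inverse, which is the identity proved here. *)
Lemma mobius_sum_left (F : finFieldType) (E : vectType F) (U V : {vspace E}) :
  \sum_(W : {vspace E} | (U <= W <= V)%VS) mobius W V = (U == V)%:R.
Proof.
pose L : finType := {vspace E}.
pose Mu := \matrix_(i < #|L|, j < #|L|)
  mobius (enum_val i : L) (enum_val j : L).
pose Ze := \matrix_(i < #|L|, j < #|L|)
  (((enum_val i : {vspace E}) <= (enum_val j : {vspace E}))%VS%:R : int).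
have MuZe : Mu *m Ze = 1%:M.
  apply/matrixP=> i j; rewrite !mxE -(inj_eq enum_val_inj) -mobius_sum_right.
  rewrite [X in _ = X]big_mkcond (reindex _ (onW_bij _ (@enum_val_bij L))) /=.
  apply: eq_bigr => k _.
  by rewrite !mxE; case: ifP; rewrite ?mulr1 ?mulr0.
have := mulmx1C MuZe => /matrixP /(_ (enum_rank (U : L)) (enum_rank (V : L))).
rewrite !mxE (inj_eq enum_rank_inj) => <-.
rewrite big_mkcond (reindex _ (onW_bij _ (@enum_val_bij L))) /=.
apply: eq_bigr => k _.
rewrite !mxE !enum_rankK; case: (U <= _)%VS; rewrite ?mul0r ?mul1r //=.
by case: ifPn => // /mobius_notsub ->.
Qed.

(** * Summing characteristic polynomials of contractions *)

Section AntiInvolution.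
Variables (F : finFieldType) (E : vectType F) (D : lattice_anti_involution E).
Implicit Types U X : {vspace E}.

Lemma perp_sub U (V : {vspace E}) : (D U <= D V)%VS = (V <= U)%VS.
Proof.
by apply/idP/idP=> [/(perp_anti D)|]; [rewrite !perpK | apply: perp_anti].
Qed.

Lemma reindex_perp (R : Type) (idx : R) (op : Monoid.com_law idx)
    (P : pred {vspace E}) (G : {vspace E} -> R) :
  \big[op/idx]_(U | P U) G U = \big[op/idx]_(U | P (D U)) G (D U).
Proof. by apply/reindex/onW_bij/inv_bij/perpK. Qed.

(** Taking orthogonals maps the subspaces counted here to the s-dimensional
    subspaces of D X. *)
Lemma card_supspaces_perp (K : fieldType) X s : [pchar K] =i pred0 ->
  (s <= \dim {:E} - \dim X)%N ->
  #|[pred U : {vspace E} | (X <= U)%VS && (\dim U == \dim {:E} - s)%N]|%:R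
    = gauss_coef K #|F| (\dim {:E} - \dim X) s.
Proof.
move=> K0 le_s; rewrite -(dim_perp D) -card_subspaces ?dim_perp //.
congr _%:R; rewrite -!sum1_card reindex_perp; apply: eq_bigl => U.
rewrite !inE -{1}(perpK D X) perp_sub dim_perp.
by have := dimvS (subvf U); case: (_ <= _)%VS => //= ; lia.
Qed.

(** With T = D X, the condition X <= U reads D U <= T.  In the exchanged sum the
    monomial of Y gets the coefficient sum_(D U <= T <= Y) mobius T Y, and only
    Y = D U survives. *)
Lemma sum_charpol_sub r (M : qrpolymatroid r E) U :
  \sum_(X : {vspace E} | (X <= U)%VS) charpol (contract_to D M X)
    = 'X^(M fullv - M (D U)).
Proof.
rewrite reindex_perp /=.
under eq_bigr => T _ do rewrite /contract_to charpol_contract perpK.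
rewrite (exchange_big_dep (fun Y => (D U <= Y)%VS)) /=; last first.
  by move=> T Y sTU; apply: subv_trans; rewrite -perp_sub perpK.
have collapse Y : \sum_(T : {vspace E} | (D T <= U)%VS && (T <= Y)%VS)
    mobius T Y *: 'X^(M fullv - M Y) = (D U == Y)%:R *: 'X^(M fullv - M Y).
  rewrite -scaler_suml -mobius_sum_left; congr (_ *: _).
  by apply: eq_bigl => T; rewrite -[(D T <= U)%VS]perp_sub perpK.
rewrite (bigD1 (D U)) ?subvv //= collapse eqxx scale1r.
rewrite big1 ?addr0 // => Y /andP[_ neY].
by rewrite collapse eq_sym (negPf neY) scale0r.
Qed.

(** Double counting of the pairs X <= U with dim U = k: summing over X first
    gives the right-hand side by sum_charpol_sub, and summing over U first gives
    each X the number of its k-dimensional overspaces.  The coefficients c are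
    left abstract because the two sides of the duality express that number by
    different Gaussian coefficients. *)
Lemma sum_weight_enum r (M : qrpolymatroid r E) (k : nat)
    (c : nat -> {fraction {poly int}}) :
  (forall X, (\dim X <= k)%N ->
     c (\dim X) = #|[pred U : {vspace E} | (X <= U)%VS && (\dim U == k)]|%:R) ->
  \sum_(0 <= i < k.+1) c i * tofrac (weight_enum D M i)
    = \sum_(U : {vspace E} | \dim U == k) tofrac 'X ^+ (M fullv - M (D U)).
Proof.
move=> cE.
under [RHS]eq_bigr => U _ do rewrite -tofracXn -sum_charpol_sub raddf_sum.
rewrite (exchange_big_dep (fun X => (\dim X <= k)%N)) /=; last first.
  by move=> U X /eqP <-; apply: dimvS.
rewrite (partition_big (fun X => inord (\dim X) : 'I_k.+1) predT) //= big_mkord.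
apply: eq_bigr => i _; rewrite /weight_enum raddf_sum mulr_sumr.
apply: eq_big => [X|X /eqP dX].
  have := ltn_ord i; rewrite -val_eqE /= ltnS => le_ik.
  by have [leXk|] := leqP (\dim X) k; [rewrite inordK | lia].
rewrite -dX cE ?dX -1?ltnS // sumr_const mulr_natl.
by congr (_ *+ _); apply: eq_card => U; rewrite !inE andbC.
Qed.

(** The rank of E cancels in the difference of the two values of the dual rank
    function, which leaves r n - r (n - dim U) - rho U. *)
Lemma corank_dual_perp r (M : qrpolymatroid r E) U :
  (dual D M fullv - dual D M (D U) + M U = r * \dim U)%N.
Proof.
have D1 : D fullv = 0%VS.
  by apply/eqP; rewrite -dimv_eq0 dim_perp subnn.
have M0 : M 0%VS = 0%N by have := rk_le_dim M 0%VS; rewrite dimv0 muln0; lia.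
have := dual_rkE D M fullv; have := dual_rkE D M (D U).
rewrite D1 M0 perpK dim_perp addn0 /=.
have := rk_le_dim M U; have := dimvS (subvf U).
move: (\dim U) (\dim _) (M U) => u n m le_un; rewrite mulnBr.
have := leq_mul (leqnn r) le_un; lia.
Qed.

End AntiInvolution.

(** * The duality identity *)

Lemma pchar_fraction_poly_int : [pchar {fraction {poly int}}] =i pred0.
Proof.
apply/pcharf0P => m; rewrite -(rmorph_nat (@tofrac {poly int})) tofrac_eq0.
by rewrite -polyC_natr polyC_eq0 pnatr_eq0.
Qed.

Theorem theorem59 (F : finFieldType) (n r : nat) (E : vectType F)
    (n_gt0 : (0 < n)%N) (r_gt0 : (0 < r)%N) (dimE : \dim {:E} = n)
    (D : lattice_anti_involution E) (M : qrpolymatroid r E)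
    (s : nat) (s_le_n : (s <= n)%N) :
  \sum_(0 <= i < (n - s).+1)
     gauss_coef {fraction {poly int}} #|F| (n - i) s
       * tofrac (weight_enum D M i)
  = tofrac 'X ^ ((M fullv)%:Z - (r * s)%N%:Z)
    * \sum_(0 <= i < s.+1)
        gauss_coef {fraction {poly int}} #|F| (n - i) (s - i)
          * tofrac (weight_enum D (dual D M) i).
Proof.
have K0 := pchar_fraction_poly_int.
have X0 : tofrac 'X != 0 :> {fraction {poly int}}.
  by rewrite tofrac_eq0 polyX_eq0.
rewrite (sum_weight_enum D M) => [|X leXk]; last first.
  by rewrite -dimE (card_supspaces_perp D) // dimE;
     have := dimvS (subvf X); lia.
rewrite (sum_weight_enum D (dual D M)) => [|X leXs]; last first.
  by rewrite -dimE card_supspaces // leXs dimE.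
(* On the left U becomes D U, so that both sums run over dimension s. *)
rewrite (reindex_perp D) mulr_sumr; apply: eq_big => [U|U].
  by rewrite dim_perp dimE; have := dimvS (subvf U); lia.
rewrite dim_perp dimE => dU; have {dU} dU : \dim U = s.
  by have := dimvS (subvf U); lia.
rewrite perpK !exprnP -expfzDr //; congr (_ ^ _).
have := corank_dual_perp D M U; have := rk_mono M (subvf U).
by rewrite dU; lia.
Qed.
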